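(* Let $n=2p+1$ and $1\le k\le n$ be integers, and let $$d=(d_1,\ldots,d_p,d_1,\ldots,d_p,d_{2p+1})\in\Delta_{n,k}$$ be such that the sum of any $n-k$ entries of $d$ at pairwise distinct positions in $\{1,\ldots,n\}$ is at least $1$. (a) Assume $p\ge k-1$. Fix $(d'_1,\ldots,d'_p)\in\Delta_{p,k-1}$ which is $(k-1)$-admissible. If $$d_1>\tfrac12 d'_1,\ \ldots,\ d_p>\tfrac12 d'_p,$$ then $d$ is $k$-admissible. (b) Assume $p<k-1$. Fix $(d'_1,\ldots,d'_p)\in\Delta_{p,n-k-1}$ which is $(n-k-1)$-admissible. If $$1-d_1>\tfrac12 d'_1,\ \ldots,\ 1-d_p>\tfrac12 d'_p,$$ then $d$ is $k$-admissible.
   Context: For integers $1\le l\le m$, $\Delta_{m,l}=\{x\in\mathbb{R}^m\mid 0\le x_i\le 1 \text{ for all } i,\ x_1+\cdots+x_m=l\}$. For $d=(d_1,\ldots,d_m)\in\Delta_{m,l}$, $\mathcal{F}^d_{m,l}$ denotes the space of all real $l\times m$ matrices $F=[f_1|\ldots|f_m]$ (columns $f_j\in\mathbb{R}^l$) such that $FF^t=I_l$ and $\|f_j\|^2=d_j$ for all $1\le j\le m$, with the subspace topology from ${\rm Mat}_{l\times m}(\mathbb{R})$. The vector $d\in\Delta_{m,l}$ is called $l$-admissible if $\mathcal{F}^d_{m,l}$ is connected. (The assumption on sums of $n-k$ entries forces $k\ge 2$ and $n-k\ge 2$, so that $k-1\ge1$ and $n-k-1\ge 1$.) *)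

(* Defs.v *)
From mathcomp Require Import all_boot all_order all_algebra.
From mathcomp Require Import all_classical all_reals all_analysis.
Import Order.TTheory GRing.Theory Num.Theory.
Import numFieldNormedType.Exports.

Set Implicit Arguments.
Unset Strict Implicit.
Unset Printing Implicit Defensive.

Local Open Scope classical_set_scope.
Local Open Scope ring_scope.

(* Delta_{m,l}; only meaningful for 1 <= l <= m. *)
Definition Delta (R : realType) (m l : nat) : set 'rV[R]_m :=
  [set x | (forall i : 'I_m, 0 <= x 0 i <= 1) /\ \sum_(i < m) x 0 i = l%:R].
Arguments Delta {R} m l _.

(* The Euclidean norm is written out because the library norm on matrices is
   the sup norm. *)
Definition col_sqnorm (R : realType) (l m : nat) (F : 'M[R]_(l, m))
    (j : 'I_m) : R :=
  \sum_(i < l) F i j ^+ 2.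

Definition frames (R : realType) (m l : nat) (d : 'rV[R]_m) :
    set 'M[R]_(l, m) :=
  [set F | F *m F^T = 1%:M /\ forall j : 'I_m, col_sqnorm F j = d 0 j].
Arguments frames {R m} l d _.

(* The library predicate [connected] on a subset of a topological space is
   connectedness for the subspace topology; the topology on 'M[R]_(l, m) is the
   usual (product) one. [connected set0] holds, but [frames l d] is nonempty
   whenever d is in Delta_{m,l} (Schur-Horn), so this convention is harmless
   there. *)
Definition admissible (R : realType) (m l : nat) (d : 'rV[R]_m) : Prop :=
  connected (frames l d).
Arguments admissible {R m} l d.

(* (e_1, ..., e_p, e_1, ..., e_p, c), a vector of length 2p + 1. *)
Definition doubled (R : realType) (p : nat) (e : 'rV[R]_p) (c : R) :
    'rV[R]_(p + p + 1) :=
  row_mx (row_mx e e) (const_mx c).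

(* Main.v *)
(** Every matrix [F] whose columns satisfy [\sum_(f_j in U) d_j <= dim U] for
    all subspaces [U] can be brought arbitrarily close to [frames k d] by a
    rescaling of its columns followed by an orthonormalization of its rows.
    The rescaling is found by gradient descent on the convex function
    [x |-> ln \det(F diag(e^x) F^T) - <d, x>], so it depends continuously on
    [F] after any fixed number of steps, and it fixes [frames k d].
    The hypothesis on sums of [n - k] entries, which says that [k] entries
    always sum to at most [k - 1], makes the set of matrices violating the
    condition of codimension at least two. Hence any two frames are joined by a
    compact connected set avoiding it; rescaling gives a connected set that
    contains both frames and is as close to [frames k d] as desired, so the
    compact set [frames k d] is not a union of two disjoint nonempty closed
    subsets. *)
Require Import Defs.
From mathcomp Require Import all_boot all_order all_algebra all_fingroup.
From mathcomp Require Import all_classical all_reals all_analysis.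
From mathcomp Require Import ring lra.
Import Order.TTheory GRing.Theory Num.Theory.
Import numFieldNormedType.Exports.

Set Implicit Arguments.
Unset Strict Implicit.
Unset Printing Implicit Defensive.

Local Open Scope classical_set_scope.
Local Open Scope ring_scope.

(** * Cauchy-Binet and Gram-Schmidt *)

(** Multilinearity in the rows: each row of [A *m B] is a combination of rows of [B], and [f]
    records which row of [B] is picked for each row of the product. *)
Lemma det_mulmx_ffun (R : comNzRingType) k n (A : 'M[R]_(k, n)) (B : 'M[R]_(n, k)) :
  \det (A *m B) =
  \sum_(f : {ffun 'I_k -> 'I_n}) (\prod_i A i (f i)) * \det (rowsub f B).
Proof.
rewrite /determinant.
under eq_bigr => s _.
  under eq_bigr => i _ do rewrite mxE.
  rewrite bigA_distr_bigA /= big_distrr /=.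
  over.
rewrite exchange_big /=; apply: eq_bigr => f _.
rewrite big_distrr /=; apply: eq_bigr => s _.
rewrite big_split /= mulrCA; congr (_ * (_ * _)).
by apply: eq_bigr => i _; rewrite !mxE.
Qed.

(** Summing over all functions instead of [k]-subsets counts every subset once per ordering, whence
    the factorial; non-injective functions contribute 0. Expanding [\det (colsub f A)] over
    permutations [s] and reindexing by [f \o s] turns each [s] into one copy of [\det (A *m B)]. *)
Lemma cauchy_binet (R : comNzRingType) k n (A : 'M[R]_(k, n)) (B : 'M[R]_(n, k)) :
  k`!%:R * \det (A *m B) =
  \sum_(f : {ffun 'I_k -> 'I_n}) \det (colsub f A) * \det (rowsub f B).
Proof.
rewrite [RHS](eq_bigr (fun f : {ffun 'I_k -> 'I_n} => \sum_(s : 'S_k)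
  (\prod_i A i (f (s i))) * \det (rowsub (finfun (f \o s)) B))); last first.
  move=> f _; rewrite big_distrl /=; apply: eq_bigr => s _.
  have -> : rowsub (finfun (f \o s)) B = row_perm s (rowsub f B).
    by apply/matrixP => i j; rewrite !mxE ffunE.
  rewrite row_permE det_mulmx det_perm mulrCA mulrA; congr (_ * _ * _).
  by apply: eq_bigr => i _; rewrite mxE.
rewrite exchange_big /= [RHS](eq_bigr (fun=> \det (A *m B))).
  by rewrite sumr_const mulr_natl card_Sn.
move=> s _; rewrite det_mulmx_ffun.
have bij : bijective (fun f : {ffun 'I_k -> 'I_n} => finfun (f \o s)).
  exists (fun f : {ffun 'I_k -> 'I_n} => finfun (f \o (s^-1)%g)) => f;
  by apply/ffunP => i; rewrite !ffunE /= ffunE /= ?permK ?permKV.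
rewrite [RHS](reindex (fun f : {ffun 'I_k -> 'I_n} => finfun (f \o s))); last exact: onW_bij.
by apply: eq_bigr => f _; congr (_ * _); apply: eq_bigr => i _; rewrite ffunE.
Qed.

(** The same block matrix is factored in two ways, one for each Schur complement. *)
Lemma det_1D_mul_col_row (R : comNzRingType) k (u : 'cV[R]_k) (v : 'rV[R]_k) :
  \det (1%:M + u *m v) = 1 + (v *m u) 0 0.
Proof.
have E1 : block_mx 1%:M (- u) v 1%:M =
    block_mx 1%:M 0 v 1%:M *m block_mx 1%:M (- u) 0 (1%:M + v *m u).
  by rewrite mulmx_block !mulmx1 !mul1mx !mul0mx !addr0 mulmxN addrCA addNr addr0.
have E2 : block_mx 1%:M (- u) v 1%:M =
    block_mx (1%:M + u *m v) (- u) 0 1%:M *m block_mx 1%:M 0 v 1%:M.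
  by rewrite mulmx_block !mulmx1 !mul1mx !mul0mx !add0r mulmx0 mulNmx add0r addrK.
have := congr1 determinant E1; rewrite {1}E2 !det_mulmx !det_lblock !det_ublock !det1.
by rewrite !(mul1r, mulr1) det_mx11 !mxE.
Qed.

Definition minor (R : comNzRingType) k n (F : 'M[R]_(k, n)) (f : {ffun 'I_k -> 'I_n}) : R :=
  \det (colsub f F).

Lemma minor_eq0 (R : comNzRingType) k n (F : 'M[R]_(k, n)) (f : {ffun 'I_k -> 'I_n}) i i' :
  i != i' -> col (f i) F = col (f i') F -> minor F f = 0.
Proof.
move=> ii' /colP ff; rewrite /minor -det_tr; apply: (determinant_alternate ii') => j.
by have := ff j; rewrite !mxE.
Qed.

Lemma minor_mul_diag (R : comNzRingType) k n (L : 'M[R]_k) (F : 'M[R]_(k, n))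
    (y : 'rV[R]_n) (f : {ffun 'I_k -> 'I_n}) :
  minor (L *m F *m diag_mx y) f = \det L * minor F f * \prod_i y 0 (f i).
Proof.
rewrite /minor -det_mulmx.
have -> : \prod_i y 0 (f i) = \det (diag_mx (\row_i y 0 (f i))).
  by rewrite det_diag; apply: eq_bigr => i _; rewrite mxE.
rewrite -det_mulmx; congr (\det _); apply/matrixP => i j.
by rewrite mul_mx_diag mul_mx_diag !mxE; congr (_ * _); apply: eq_bigr => l _; rewrite !mxE.
Qed.

Definition occ k n (f : {ffun 'I_k -> 'I_n}) (j : 'I_n) : nat := #|[pred i | f i == j]|.

Lemma sum_occ (R : pzRingType) k n (f : {ffun 'I_k -> 'I_n}) (x : 'I_n -> R) :
  \sum_j (occ f j)%:R * x j = \sum_i x (f i).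
Proof.
rewrite (partition_big f predT) //=; apply: eq_bigr => j _.
rewrite (eq_bigr (fun=> x j)); last by move=> i /eqP ->.
by rewrite sumr_const mulr_natl.
Qed.

Section parseval.
Variables (R : comNzRingType) (k n : nat) (Q : 'M[R]_(k, n)).
Hypothesis QQ : Q *m Q^T = 1%:M.

Lemma sum_sqr_minor : \sum_f minor Q f ^+ 2 = k`!%:R.
Proof.
have := cauchy_binet Q Q^T; rewrite QQ det1 mulr1 => ->; apply: eq_bigr => f _.
by rewrite expr2; congr (_ * _); rewrite /minor -det_tr; congr (\det _);
  apply/matrixP => i j; rewrite !mxE.
Qed.

(** The squared minors, divided by their sum, form a probability distribution whose marginals are
    the squared column norms. Let [B] be [Q] with column [j] set to zero. Cauchy-Binet for [B] sums
    the squared minors avoiding [j], and [\det (B *m B^T)] is 1 minus the squared norm of column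
    [j]; subtracting from the total leaves the minors that use [j]. *)
Lemma sum_sqr_minor_occ j :
  \sum_f minor Q f ^+ 2 * (occ f j)%:R = k`!%:R * \sum_i Q i j ^+ 2.
Proof.
pose B := \matrix_(i, l) (if l == j then 0 else Q i l).
have BB : B *m B^T = 1%:M + (- col j Q) *m (col j Q)^T.
  rewrite -QQ; apply/matrixP => a b; rewrite !mxE big_ord1 !mxE mulNr.
  apply/eqP; rewrite eq_sym subr_eq (bigD1 j) //= [X in _ == X + _](bigD1 j) //=.
  rewrite !mxE eqxx mul0r add0r addrC; apply/eqP; congr (_ + _).
  by apply: eq_bigr => l /negPf lj; rewrite !mxE lj.
have := cauchy_binet B B^T; rewrite BB det_1D_mul_col_row.
have -> : ((col j Q)^T *m - col j Q) 0 0 = - \sum_i Q i j ^+ 2.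
  by rewrite mulmxN !mxE; congr (- _); apply: eq_bigr => i _; rewrite !mxE.
move/eqP; rewrite mulrDr mulr1 mulrN subr_eq -sum_sqr_minor addrC -subr_eq => /eqP <-.
rewrite -sumrB; apply: eq_bigr => f _.
have -> : \det (rowsub f B^T) = minor B f.
  by rewrite /minor -det_tr; congr (\det _); apply/matrixP => a b; rewrite !mxE.
rewrite -/(minor B f) -expr2.
have [i /eqP fi|nf] := pickP [pred i | f i == j].
  have -> : minor B f = 0.
    rewrite /minor -det_tr (expand_det_row _ i) big1 // => a _.
    by rewrite !mxE fi eqxx mul0r.
  rewrite expr0n subr0.
  (* If [f] takes the value [j] twice, its minor vanishes; otherwise the count is exactly 1. *)
  have [/existsP[i' /andP[ii' /eqP fi']]|/existsPn inj] :=
    boolP [exists i', (i != i') && (f i' == j)].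
    by rewrite (minor_eq0 ii') ?expr0n ?mul0r ?fi ?fi'.
  have -> : occ f j = 1%N; last by rewrite mulr1.
  rewrite /occ -(card1 i); apply: eq_card => i'; rewrite !inE.
  by have := inj i'; rewrite eq_sym; case: eqP => //= [->|_ /negPf]; rewrite ?fi ?eqxx.
rewrite /occ eq_card0 // mulr0; apply/eqP; rewrite eq_sym subr_eq0; apply/eqP.
congr (\det _ ^+ 2); apply/matrixP => a b; rewrite !mxE.
by have := nf b; rewrite /= => ->.
Qed.

End parseval.

(** Gram-Schmidt from the bottom row up: the top row is projected off the rows already
    orthonormalized below it, then normalized. Square roots and field operations suffice, which
    gives continuity on matrices of full rank. *)
Fixpoint gs (R : rcfType) n k : 'M[R]_(k, n) -> 'M[R]_(k, n) :=
  match k with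
  | 0 => id
  | k'.+1 => fun F : 'M[R]_(1 + k', n) =>
      let Q := gs (dsubmx F) in
      let v := usubmx F - usubmx F *m Q^T *m Q in
      col_mx ((Num.sqrt ((v *m v^T) 0 0))^-1 *: v) Q
  end.

Lemma row_free_dsubmx (K : fieldType) m k n (F : 'M[K]_(m + k, n)) : row_free F ->
  row_free (dsubmx F).
Proof.
move=> /row_freeP[B FB]; apply/row_freeP; exists (B *m col_mx 0 1%:M).
by rewrite mulmxA mul_dsub_mx FB (scalar_mx_block _ _ 1) block_mxEv col_mxKd mul_row_col
  mulmx0 mulmx1 add0r.
Qed.

Lemma mulmx_tr_ge0 (R : realDomainType) n (v : 'rV[R]_n) : 0 <= (v *m v^T) 0 0.
Proof. by rewrite mxE sumr_ge0 // => i _; rewrite mxE sqr_ge0. Qed.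

Lemma mulmx_tr_eq0 (R : realDomainType) n (v : 'rV[R]_n) : ((v *m v^T) 0 0 == 0) = (v == 0).
Proof.
apply/eqP/eqP => [|->]; last by rewrite mul0mx mxE.
rewrite mxE => /eqP; rewrite psumr_eq0 => [/allP v0|i _]; last by rewrite mxE sqr_ge0.
apply/rowP => i; have := v0 i (mem_index_enum _); rewrite !mxE -expr2 sqrf_eq0.
by move/eqP.
Qed.

(** The factor [L] matters because left multiplication by it scales all maximal minors by the same
    [\det L]. *)
Lemma gs_spec (R : rcfType) n k (F : 'M[R]_(k, n)) : row_free F ->
  gs F *m (gs F)^T = 1%:M /\ exists2 L, L \in unitmx & gs F = L *m F.
Proof.
elim: k F => [|k IH] F Ff.
  by split; [rewrite [LHS]flatmx0 [RHS]flatmx0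
             | exists 1%:M; rewrite ?unitmx1 // [LHS]flatmx0 [RHS]flatmx0].
have {IH} [QQ [L Lu QE]] := IH _ (row_free_dsubmx (Ff : row_free (F : 'M[R]_(1 + k, n)))).
rewrite /=; set Q := gs _ in QQ QE *; set u := usubmx _; set v := u - _.
have vE : v = row_mx 1%:M (- (u *m Q^T *m L)) *m F.
  by rewrite -[F in RHS](vsubmxK (F : 'M[R]_(1 + k,
    n))) mul_row_col mul1mx mulNmx -(mulmxA (u *m Q^T)) -QE.
(* By [vE], [v] is a combination of the rows of [F] with coefficient 1 at the top row, so it cannot
   vanish when the rows are free. *)
have v0 : v != 0.
  apply/negP => /eqP v0.
  have /row_freeP[B FB] : row_free (F : 'M[R]_(1 + k, n)) := Ff.
  have := congr1 (mulmx^~ B) v0; rewrite vE mul0mx -(mulmxA (row_mx _ _)) FB mulmx1 =>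
    /matrixP/(_ 0 (lshift k 0)).
  by rewrite row_mxEl !mxE => /eqP; rewrite oner_eq0.
have vv : 0 < (v *m v^T) 0 0 by rewrite lt0r mulmx_tr_eq0 v0 mulmx_tr_ge0.
have vQ : v *m Q^T = 0 by rewrite mulmxBl -(mulmxA (u *m Q^T)) QQ mulmx1 subrr.
set a := _^-1; have a0 : a != 0 by rewrite invr_eq0 sqrtr_eq0 -ltNge.
split.
  suff : col_mx (a *: v) Q *m (col_mx (a *: v) Q)^T = 1%:M by [].
  rewrite tr_col_mx mul_col_row -!scalemxAl vQ scaler0 QQ linearZ /= -!scalemxAr scalerA.
  rewrite -[Q *m v^T]trmxK trmx_mul trmxK vQ trmx0 scaler0.
  have -> : a * a *: (v *m v^T) = 1%:M.
    rewrite [v *m v^T]mx11_scalar scale_scalar_mx -expr2 exprVn sqr_sqrtr ?mulVf ?gt_eqF //.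
    exact: ltW.
  by rewrite -scalar_mx_block.
exists (block_mx a%:M (a *: - (u *m Q^T *m L)) 0 L).
  suff : block_mx a%:M (a *: - (u *m Q^T *m L)) 0 L \in unitmx by [].
  by rewrite unitmxE det_ublock unitrM det_scalar1 unitfE a0 -unitmxE.
suff : col_mx (a *: v) Q = block_mx a%:M (a *: - (u *m Q^T *m L)) 0 L *m (F : 'M[R]_(1 + k,
  n)) by [].
rewrite -[F in RHS](vsubmxK (F : 'M[R]_(1 + k, n))) mul_block_col mul0mx add0r -QE;
  congr col_mx.
rewrite mul_scalar_mx -scalemxAl -scalerDr; congr (_ *: _).
by rewrite mulNmx -(mulmxA (u *m Q^T)) -QE.
Qed.

Lemma gs_id (R : rcfType) n k (F : 'M[R]_(k, n)) : F *m F^T = 1%:M -> gs F = F.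
Proof.
elim: k F => [//|k IH] F; rewrite -[F](vsubmxK (F : 'M[R]_(1 + k, n))).
set u := usubmx _; set G := dsubmx _ => FF.
have : col_mx u G *m (col_mx u G)^T = 1%:M := FF.
rewrite tr_col_mx mul_col_row (scalar_mx_block _ _ 1) => /eq_block_mx[uu uG _ GG].
rewrite /= col_mxKu col_mxKd (IH _ GG) uG mul0mx subr0 uu.
by rewrite mxE eqxx sqrtr1 invr1 scale1r.
Qed.

(** * Gradient descent for log-sum-exp *)

Definition dot (R : pzRingType) n (x y : 'rV[R]_n) : R := \sum_j x 0 j * y 0 j.
Notation sqn x := (dot x x).

Section dot.
Variables (R : realFieldType) (n : nat).
Implicit Types (x y z : 'rV[R]_n) (c : R).

Lemma dotC x y : dot x y = dot y x.
Proof. by apply: eq_bigr => j _; rewrite mulrC. Qed.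

Lemma dotDl x y z : dot (x + y) z = dot x z + dot y z.
Proof. by rewrite -big_split; apply: eq_bigr => j _; rewrite mxE mulrDl. Qed.

Lemma dotZl c x z : dot (c *: x) z = c * dot x z.
Proof. by rewrite /dot big_distrr /=; apply: eq_bigr => j _; rewrite mxE mulrA. Qed.

Lemma dotNl x z : dot (- x) z = - dot x z.
Proof. by rewrite -scaleN1r dotZl mulN1r. Qed.

Lemma dotDr x y z : dot z (x + y) = dot z x + dot z y.
Proof. by rewrite dotC dotDl !(dotC z). Qed.

Lemma dotZr c x z : dot z (c *: x) = c * dot z x.
Proof. by rewrite dotC dotZl dotC. Qed.

Lemma dotNr x z : dot z (- x) = - dot z x.
Proof. by rewrite dotC dotNl dotC. Qed.

Definition dotE := (dotDl, dotDr, dotZl, dotZr, dotNl, dotNr).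

Lemma sqn_ge0 x : 0 <= sqn x.
Proof. by apply: sumr_ge0 => j _; rewrite -expr2 sqr_ge0. Qed.

Lemma sqn_eq0 x : sqn x = 0 -> x = 0.
Proof.
move=> /eqP; rewrite psumr_eq0 => [/allP x0|j _]; last by rewrite -expr2 sqr_ge0.
by apply/rowP => j; have := x0 j (mem_index_enum _); rewrite mxE -expr2 sqrf_eq0 => /eqP.
Qed.

Lemma dot_sqr_le x y : dot x y ^+ 2 <= sqn x * sqn y.
Proof.
have [/sqn_eq0 ->|y0] := eqVneq (sqn y) 0.
  by rewrite -(scale0r (0 : 'rV[R]_n)) !dotZr !mul0r mulr0 expr0n.
have ygt0 : 0 < sqn y by rewrite lt0r y0 sqn_ge0.
have := sqn_ge0 (sqn y *: x - dot x y *: y); rewrite !dotE (dotC y x) => h.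
rewrite -subr_ge0 -(pmulr_rge0 _ ygt0); apply: le_trans h _.
by rewrite le_eqVlt; apply/orP; left; apply/eqP; ring.
Qed.

Lemma sqnB_le x y : sqn (x - y) <= 2 * sqn x + 2 * sqn y.
Proof.
have := sqn_ge0 (x + y); rewrite !dotE (dotC y x); lra.
Qed.

End dot.

(** From [1 - z <= expR (- z)] one gets [expR z * (1 - z) <= 1], and the right-hand side times
    [1 - z] exceeds 1 by [z ^+ 2 * (1 - 2 * z)]. *)
Lemma expR_le_quadratic (R : realType) (z : R) : z <= 1 / 2 -> expR z <= 1 + z + 2 * z ^+ 2.
Proof.
move=> hz; have hz1 : 0 < 1 - z by lra.
have : 1 - z <= expR (- z) by have := expR_ge1Dx (- z); lra.
rewrite expRN => h; have e0 := expR_gt0 z.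
have : expR z * (1 - z) <= 1 by rewrite -ler_pdivlMl // mulr1.
move=> h2; have : expR z * (1 - z) <= (1 + z + 2 * z ^+ 2) * (1 - z).
  apply: le_trans h2 _; rewrite -subr_ge0.
  have -> : (1 + z + 2 * z ^+ 2) * (1 - z) - 1 = z ^+ 2 * (1 - 2 * z) by ring.
  by apply: mulr_ge0; rewrite ?sqr_ge0 //; lra.
by rewrite ler_pM2r.
Qed.

Section log_sum_exp.
Variables (R : realType) (n : nat) (I : finType) (a : I ->
  'rV[R]_n) (d : 'rV[R]_n) (w : I -> R).
Hypotheses (w_ge0 : forall f, 0 <= w f) (w_gt0 : 0 < \sum_f w f).
Implicit Types x y h : 'rV[R]_n.

Definition sumexp x := \sum_f w f * expR (dot (a f) x).
(** The gradient of [ln \o sumexp] at [x]: the expectation of [a f] under the Gibbs weights [prob x]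
    below. *)
Definition mean x : 'rV[R]_n :=
  \row_j ((\sum_f w f * expR (dot (a f) x) * a f 0 j) / sumexp x).

(** Dominates all [sqn (a f)] and [sqn d], and is at least 1. With step [(4 * bound)^-1], the
    numbers [stepsize * dot (a f) g] have absolute value at most 1/2 as soon as
    [sqn g <= 4 * bound], so [expR_le_quadratic] applies to them. *)
Let bound : R := \sum_f sqn (a f) + sqn d + 1.
Definition stepsize : R := (4 * bound)^-1.
Definition descent x := x - stepsize *: (mean x - d).

Let prob x f := w f * expR (dot (a f) x) / sumexp x.

Lemma sumexp_gt0 x : 0 < sumexp x.
Proof.
have [f fP|w0] := pickP [pred f | 0 < w f]; last first.
  by move: w_gt0; rewrite big1 ?ltxx // => f _; apply/eqP; rewrite eq_le w_ge0 leNgt andbT;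
    exact/negbT/w0.
rewrite /sumexp (bigD1 f) //= ltr_pwDl ?mulr_gt0 ?expR_gt0 ?sumr_ge0 // => g _.
by rewrite mulr_ge0 ?w_ge0 ?expR_ge0.
Qed.

Let prob_ge0 x f : 0 <= prob x f.
Proof. by rewrite divr_ge0 ?mulr_ge0 ?w_ge0 ?expR_ge0 // ltW ?sumexp_gt0. Qed.

Let sum_prob x : \sum_f prob x f = 1.
Proof. by rewrite -big_distrl /= divff // gt_eqF ?sumexp_gt0. Qed.

Let sum_prob_mul x t : \sum_f prob x f * t = t.
Proof. by rewrite -big_distrl /= sum_prob mul1r. Qed.

Let dot_mean x h : dot (mean x) h = \sum_f prob x f * dot (a f) h.
Proof.
rewrite /dot; under [RHS]eq_bigr do rewrite big_distrr /=.
rewrite exchange_big /=; apply: eq_bigr => j _; rewrite mxE !big_distrl /=.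
by apply: eq_bigr => f _; rewrite /prob; ring.
Qed.

Let sumexpD x h : sumexp (x + h) = sumexp x * \sum_f prob x f * expR (dot (a f) h).
Proof.
rewrite big_distrr /=; apply: eq_bigr => f _; rewrite dotDr expRD /prob.
by have := sumexp_gt0 x; move=> /lt0r_neq0 Z0; field.
Qed.

Let bound_ge1 : 1 <= bound.
Proof. by rewrite lerDr addr_ge0 ?sqn_ge0 ?sumr_ge0 // => f _; rewrite sqn_ge0. Qed.

Let sqn_a f : sqn (a f) <= bound.
Proof.
rewrite /bound (bigD1 f) //= -!addrA lerDl !addr_ge0 ?sqn_ge0 ?sumr_ge0 // => g _.
exact: sqn_ge0.
Qed.

Let sqn_d : sqn d <= bound.
Proof. by rewrite /bound addrAC lerDr addr_ge0 ?sumr_ge0 // => g _; exact: sqn_ge0. Qed.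

Let sqn_mean x : sqn (mean x) <= bound.
Proof.
have : sqn (mean x) <= \sum_f prob x f * ((sqn (a f) + sqn (mean x)) / 2).
  rewrite {1}dot_mean; apply: ler_sum => f _; apply: ler_wpM2l => //.
  have := sqn_ge0 (a f - mean x); rewrite !dotE (dotC (mean x)); lra.
have : \sum_f prob x f * ((sqn (a f) + sqn (mean x)) / 2) <=
       \sum_f prob x f * ((bound + sqn (mean x)) / 2).
  by apply: ler_sum => f _; apply: ler_wpM2l => //; have := sqn_a f; lra.
rewrite sum_prob_mul; lra.
Qed.

Lemma stepsize_gt0 : 0 < stepsize.
Proof. by rewrite invr_gt0; have := bound_ge1; lra. Qed.

Let step0 := stepsize_gt0.

Let stepsizeE : bound = (4 * stepsize)^-1.
Proof. by rewrite /stepsize; have := bound_ge1 => b; field; lra. Qed.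

(** Convexity, in the form of Jensen's inequality: average [1 + u <= expR u] over [prob x] at
    [u = dot (a f) h - t], where [t] is the mean of [dot (a f) h]. *)
Let ln_sumexp_ge x h : ln (sumexp x) + dot (mean x) h <= ln (sumexp (x + h)).
Proof.
rewrite sumexpD lnM ?posrE ?sumexp_gt0 //; last first.
  by rewrite -(pmulr_rgt0 _ (sumexp_gt0 x)) -sumexpD sumexp_gt0.
rewrite lerD2l -[leLHS]expRK; set t := dot _ h.
have le : expR t <= \sum_f prob x f * expR (dot (a f) h).
  rewrite -[leLHS]mulr1 -ler_pdivlMl ?expR_gt0 // -expRN big_distrr /=.
  have -> : 1 = \sum_f prob x f * (1 + (dot (a f) h - t)).
    rewrite (eq_bigr (fun f => prob x f + prob x f * dot (a f) h - prob x f * t)) =>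
      [|f _]; last ring.
    by rewrite !big_split /= sumrN sum_prob_mul sum_prob -dot_mean addrK.
  apply: ler_sum => f _; rewrite mulrCA -expRD; apply: ler_wpM2l => //.
  by rewrite [- t + _]addrC expR_ge1Dx.
by rewrite ler_ln ?posrE ?expR_gt0 // (lt_le_trans (expR_gt0 t)).
Qed.

(** Smoothness: the function lies below a quadratic with the same tangent. Each exponential is
    bounded by its quadratic majorant, and the average is bounded through [1 + u <= expR u]. *)
Let ln_sumexp_le x g : sqn g <= 4 * bound ->
  ln (sumexp (x - stepsize *: g)) <=
  ln (sumexp x) - stepsize * dot (mean x) g + stepsize / 2 * sqn g.
Proof.
move=> gb; rewrite sumexpD lnM ?posrE ?sumexp_gt0 //; last first.
  by rewrite -(pmulr_rgt0 _ (sumexp_gt0 x)) -sumexpD sumexp_gt0.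
rewrite -addrA lerD2l -[leRHS]expRK ler_ln ?posrE ?expR_gt0 //; last first.
  by rewrite -(pmulr_rgt0 _ (sumexp_gt0 x)) -sumexpD sumexp_gt0.
apply: le_trans (expR_ge1Dx _).
have fb f : dot (a f) g ^+ 2 <= bound * sqn g.
  by apply: le_trans (dot_sqr_le _ _) _; rewrite ler_wpM2r ?sqn_ge0.
apply: (@le_trans _ _ (\sum_f prob x f * (1 - stepsize * dot (a f) g + stepsize / 2 * sqn g))).
  apply: ler_sum => f _; apply: ler_wpM2l => //; rewrite dotNr dotZr.
  apply: le_trans (expR_le_quadratic _) _.
    have : (stepsize * dot (a f) g) ^+ 2 <= (1 / 2) ^+ 2.
      rewrite exprMn; apply: (@le_trans _ _ (stepsize ^+ 2 * (4 * bound ^+ 2))).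
        rewrite ler_wpM2l ?sqr_ge0 //; apply: le_trans (fb f) _.
        by have := bound_ge1; nra.
      by rewrite stepsizeE le_eqVlt; apply/orP; left; apply/eqP; field; rewrite gt_eqF.
    by set s := stepsize * _ => s2; rewrite leNgt; apply/negP => s1; nra.
  rewrite lerD2l sqrrN exprMn.
  (* Since [bound * stepsize] is 1/4, this is the quadratic term of the claim. *)
  apply: (@le_trans _ _ (2 * (stepsize ^+ 2 * (bound * sqn g)))).
    by rewrite ler_wpM2l // ler_wpM2l ?sqr_ge0.
  by rewrite stepsizeE le_eqVlt; apply/orP; left; apply/eqP; field; rewrite gt_eqF.
rewrite (eq_bigr (fun f => prob x f * (1 + stepsize / 2 * sqn g) - stepsize * (prob x f *
  dot (a f) g)))
   => [|f _]; last ring.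
by rewrite big_split /= sum_prob_mul sumrN -big_distrr /= -dot_mean; lra.
Qed.

Lemma ln_sumexp_descent x :
  ln (sumexp (descent x)) - dot d (descent x) <=
  ln (sumexp x) - dot d x - stepsize / 2 * sqn (mean x - d).
Proof.
have gb : sqn (mean x - d) <= 4 * bound.
  by have := sqnB_le (mean x) d; have := sqn_mean x; have := sqn_d; lra.
have := ln_sumexp_le x gb; rewrite /descent !dotE (dotC d (mean x)); lra.
Qed.

(* The gradient of the convex function [ln \o sumexp] is cocoercive, so a step
   of gradient descent is nonexpansive. *)
Let cocoercive x y :
  stepsize * sqn (mean x - mean y) <= dot (mean x - mean y) (x - y).
Proof.
(* The tangent at [u] and the quadratic bound at [v] are compared at the common point
   [v - stepsize *: (mean v - mean u)]. Adding the two instances with [x] and [y] exchanged gives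
   the claim. *)
have half u v : ln (sumexp u) + dot (mean u) (v - u) + stepsize / 2 * sqn (mean v - mean u)
    <= ln (sumexp v).
  have gb : sqn (mean v - mean u) <= 4 * bound.
    by have := sqnB_le (mean v) (mean u); have := sqn_mean u; have := sqn_mean v; lra.
  have := ln_sumexp_le v gb.
  have := ln_sumexp_ge u (v - stepsize *: (mean v - mean u) - u).
  rewrite [u + _]addrC subrK !dotE (dotC (mean u) (mean v)); lra.
have := half x y; have := half y x.
rewrite !dotE (dotC (mean x) (mean y)); lra.
Qed.

(** Cocoercivity along the displacement [- stepsize *: g] gives [dot (g' - g) g' <= 0], so the
    gradient never grows. This makes the last iterate the best one and the residual monotone in the
    number of steps. *)
Lemma sqn_grad_descent x : sqn (mean (descent x) - d) <= sqn (mean x - d).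
Proof.
set g := mean x - d; set g' := mean (descent x) - d.
have := cocoercive (descent x) x.
have -> : mean (descent x) - mean x = g' - g by apply/rowP => j; rewrite !mxE; ring.
have -> : descent x - x = - (stepsize *: g) by apply/rowP => j; rewrite !mxE; ring.
rewrite dotNr dotZr -mulrN ler_pM2l //; clearbody g g'.
have := sqn_ge0 (g' - g); rewrite !dotE (dotC g' g); lra.
Qed.

(** Every step lowers the objective by at least [stepsize / 2] times the current squared gradient,
    and the last gradient is the smallest. The total decrease is limited by the lower bound [C]. *)
Lemma iter_descent_residual C N : (forall x, C + dot d x <= ln (sumexp x)) ->
  N%:R * (stepsize / 2 * sqn (mean (iter N descent 0) - d)) <= ln (sumexp 0) - C.
Proof.
move=> Cle; suff : N%:R * (stepsize / 2 * sqn (mean (iter N descent 0) - d)) <=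
  ln (sumexp 0) - (ln (sumexp (iter N descent 0)) - dot d (iter N descent 0)).
  by have := Cle (iter N descent 0); lra.
elim: N => [|N IH].
  by rewrite mul0r /= -(scale0r (0 : 'rV[R]_n)) !dotZr; lra.
have := ln_sumexp_descent (iter N descent 0); move: IH.
set x := iter N descent 0; rewrite -[iter N.+1 _ _]/(descent x) => IH.
have : N.+1%:R * (stepsize / 2 * sqn (mean (descent x) - d)) <=
       N.+1%:R * (stepsize / 2 * sqn (mean x - d)).
  by rewrite ler_wpM2l // ler_wpM2l ?sqn_grad_descent // divr_ge0 ?ltW.
rewrite -[N.+1]addn1 natrD mulrDl [X in _ <= X]mulrDl mul1r; lra.
Qed.

End log_sum_exp.

(** * Semistability *)

(** The exponent vector of the monomial by which a rescaling of the columns multiplies the minor at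
    [f]. *)
Definition occ_row (R : pzRingType) k n (f : {ffun 'I_k -> 'I_n}) : 'rV[R]_n :=
  \row_j (occ f j)%:R.

Lemma dot_occ_row (R : realFieldType) k n (f : {ffun 'I_k -> 'I_n}) (x : 'rV[R]_n) :
  dot (occ_row R f) x = \sum_i x 0 (f i).
Proof. by rewrite -(sum_occ f (x 0)); apply: eq_bigr => j _; rewrite mxE. Qed.

(** By Cauchy-Binet this is [\det (F diag(e^x) F^T)] times the factorial of [k]. *)
Definition capacity (R : realType) k n (F : 'M[R]_(k, n)) : 'rV[R]_n -> R :=
  sumexp (@occ_row R k n) (fun f => minor F f ^+ 2).

(** The subspace condition in analytic form: [ln (capacity F x) - dot d x] is bounded below, by
    [ln C]. This is the bound that gradient descent consumes. *)
Definition semistable (R : realType) k n (d : 'rV[R]_n) (F : 'M[R]_(k, n)) :=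
  exists2 C : R, 0 < C & forall x, C * expR (dot d x) <= capacity F x.

(** Jensen's inequality again: the squared minors have total mass [k] factorial, and under them the
    mean of [occ_row R f] is [d]. *)
Lemma parseval_semistable (R : realType) k n (d : 'rV[R]_n) (F : 'M[R]_(k, n)) :
  F *m F^T = 1%:M -> (forall j, \sum_i F i j ^+ 2 = d 0 j) -> semistable d F.
Proof.
move=> FF Fd; exists k`!%:R; first by rewrite ltr0n fact_gt0.
move=> x; set t := dot d x.
have tE : \sum_f minor F f ^+ 2 * dot (occ_row R f) x = k`!%:R * t.
  under eq_bigr do rewrite /dot big_distrr /=.
  rewrite exchange_big big_distrr /=; apply: eq_bigr => j _.
  rewrite -Fd mulrA -(sum_sqr_minor_occ FF) big_distrl /=.
  by apply: eq_bigr => f _; rewrite mxE mulrA.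
have -> : k`!%:R * expR t =
    \sum_f minor F f ^+ 2 * (expR t * (1 + (dot (occ_row R f) x - t))).
  have -> : \sum_f minor F f ^+ 2 * (expR t * (1 + (dot (occ_row R f) x - t))) =
      expR t * (\sum_f minor F f ^+ 2 + \sum_f minor F f ^+ 2 * dot (occ_row R f) x
        - (\sum_f minor F f ^+ 2) * t).
    rewrite mulr_suml -big_split /= -sumrB mulr_sumr.
    by apply: eq_bigr => f _; ring.
  rewrite tE (sum_sqr_minor FF); ring.
apply: ler_sum => f _; rewrite ler_wpM2l ?sqr_ge0 //.
rewrite -[X in _ <= expR X](subrK t) expRD mulrC.
by rewrite ler_wpM2r ?expR_ge0 ?expR_ge1Dx.
Qed.

Definition upd k n (f : {ffun 'I_k -> 'I_n}) i b : {ffun 'I_k -> 'I_n} :=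
  [ffun i' => if i' == i then b else f i'].

Lemma upd_inj k n (f : {ffun 'I_k -> 'I_n}) i b :
  injective f -> b \notin codom f -> injective (upd f i b).
Proof.
move=> fI bf u v; rewrite !ffunE.
case: eqP => [->|ui]; case: eqP => [->|vi] //; last exact: fI.
  by move=> bE; case/negP: bf; rewrite bE codom_f.
by move=> bE; case/negP: bf; rewrite -bE codom_f.
Qed.

Lemma sum_upd (V : zmodType) k n (f : {ffun 'I_k -> 'I_n}) i b (x : 'I_n -> V) :
  \sum_i' x (upd f i b i') = \sum_i' x (f i') - x (f i) + x b.
Proof.
rewrite (bigD1 i) // [in RHS](bigD1 i) //= ffunE eqxx addrC [x (f i) + _]addrC addrK.
by congr (_ + _); apply: eq_bigr => i' /negPf ii'; rewrite ffunE ii'.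
Qed.

Lemma occ_injE k n (f : {ffun 'I_k -> 'I_n}) j : injective f -> occ f j = (j \in codom f).
Proof.
move=> fI; rewrite /occ; case: codomP => [[i ->]|nj]; last first.
  by apply: eq_card0 => i; apply/negP => /eqP fi; apply: nj; exists i.
by rewrite -[RHS](card1 i); apply: eq_card => i'; rewrite !inE (inj_eq fI).
Qed.

(* The matrices violating this form a set of codimension two. *)
Definition nice (R : comNzRingType) k n (F : 'M[R]_(k, n)) :=
  forall (f : {ffun 'I_k -> 'I_n}) i b, injective f -> b \notin codom f ->
    minor F f != 0 \/ minor F (upd f i b) != 0.

Section nice_semistable.
Variables (R : realType) (k n : nat) (d : 'rV[R]_n).
Hypotheses (k_gt0 : (0 < k)%N) (kn : (k <= n)%N).
Hypotheses (d01 : forall j, 0 <= d 0 j <= 1) (sumd : \sum_j d 0 j = k%:R).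
Hypothesis dk : forall f : {ffun 'I_k -> 'I_n}, injective f -> \sum_i d 0 (f i) <= k%:R - 1.

Let sum_occ1 (f : {ffun 'I_k -> 'I_n}) : \sum_j (occ f j)%:R = k%:R :> R.
Proof.
have := sum_occ f (fun=> 1 : R); rewrite sumr_const card_ord => <-.
by apply: eq_bigr => j _; rewrite mulr1.
Qed.

(** Take the injective [f] of largest [x]-weight. It outweighs [dot d x] because the entries of [d]
    lie in [0, 1] and sum to [k]. If its minor vanishes, exchange its lightest index for the
    heaviest index outside; niceness makes the new minor nonzero, and [dk] leaves enough slack to
    pay for the loss of weight. *)
Lemma nice_heavy_basis (F : 'M[R]_(k, n)) (x : 'rV[R]_n) : nice F ->
  exists2 f : {ffun 'I_k -> 'I_n}, minor F f != 0 & dot d x <= \sum_i x 0 (f i).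
Proof.
move=> Fn.
pose f1 : {ffun 'I_k -> 'I_n} := [ffun i => widen_ord kn i].
pose P (f : {ffun 'I_k -> 'I_n}) := injectiveb f.
have f1I : P f1 by apply/injectiveP => u v; rewrite !ffunE => /(congr1 val) /= /val_inj.
have [f /injectiveP fI fmax] := Order.TotalTheory.arg_maxP (fun f : {ffun 'I_k ->
  'I_n} => \sum_i x 0 (f i)) f1I.
have exch i b : b \notin codom f -> x 0 b <= x 0 (f i).
  move=> bf; have := fmax (upd f i b) (introT (injectiveP _) (upd_inj fI bf)).
  rewrite (sum_upd f i b (x 0)) /=; lra.
have [i0 _ i0min] := Order.TotalTheory.arg_minP (fun i =>
  x 0 (f i)) (isT : predT (Ordinal k_gt0)).
pose m := x 0 (f i0).
have sumE : \sum_i x 0 (f i) - dot d x = \sum_j ((occ f j)%:R - d 0 j) * x 0 j.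
  rewrite -(sum_occ f (x 0)) -sumrN -big_split; apply: eq_bigr => j _ /=; ring.
(* Both [occ f] and [d] sum to [k], so [x] may be shifted by a constant. *)
have shift t : \sum_j ((occ f j)%:R - d 0 j) * x 0 j = \sum_j ((occ f j)%:R - d 0 j) * (x 0
  j - t).
  rewrite [RHS](eq_bigr (fun j => ((occ f j)%:R - d 0 j) * x 0 j - ((occ f j)%:R - d 0 j) *
    t)) => [|j _]; last ring.
  by rewrite big_split sumrN -big_distrl big_split sumrN /= sum_occ1 sumd subrr mul0r subr0.
have [F0|] := eqVneq (minor F f) 0; last first.
  move=> F0; exists f => //; rewrite -subr_ge0 sumE (shift m).
  apply: sumr_ge0 => j _; rewrite occ_injE //; have /andP[d0 _] := d01 j.
  case: codomP => [[i ->]|/codomP nj] /=.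
    have /andP[_ d1] := d01 (f i).
    by apply: mulr_ge0; rewrite subr_ge0 //; exact: i0min.
  by rewrite sub0r mulNr -mulrN; apply: mulr_ge0; rewrite // oppr_ge0 subr_le0 exch //;
    apply/codomP.
(* An index outside [f] exists: otherwise [dk] would bound the full sum of [d], which is [k], by
   [k - 1]. *)
have [b1 b1f|cod] := pickP [pred b | b \notin codom f]; last first.
  have := dk fI; rewrite -(sum_occ f (d 0)).
  rewrite (eq_bigr (d 0)) ?sumd; first lra.
  by move=> j _; rewrite occ_injE //; have /negbFE -> := cod j; rewrite mul1r.
have [b0 b0f b0max] := Order.TotalTheory.arg_maxP (fun b => x 0 b) b1f.
exists (upd f i0 b0); first by have [] := Fn f i0 b0 fI b0f; rewrite ?F0 ?eqxx.
rewrite (sum_upd f i0 b0 (x 0)) -/m; set m' := x 0 b0.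
have m'm : m' <= m by exact: exch.
have : m - m' <= \sum_i x 0 (f i) - dot d x; last lra.
rewrite sumE (shift m').
(* Chosen indices have [x 0 j >= m], the others [x 0 j <= m']. The sum on the left is [k] minus the
   [d]-weight of [f], hence at least 1 by [dk]. *)
have : (m - m') * \sum_j (occ f j)%:R * (1 - d 0 j) <= \sum_j ((occ f j)%:R - d 0 j) * (x 0
  j - m').
  rewrite big_distrr; apply: ler_sum => j _ /=; rewrite occ_injE //; have /andP[d0 _] := d01 j.
  case: codomP => [[i ->]|/codomP nj] /=.
    have /andP[_ d1] := d01 (f i).
    rewrite mul1r mulrC ler_wpM2l ?subr_ge0 // lerD2r; exact: i0min.
  rewrite mul0r mulr0 sub0r mulNr -mulrN; apply: mulr_ge0; rewrite // oppr_ge0 subr_le0;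
    exact: b0max.
apply: le_trans; rewrite sum_occ sumrB sumr_const card_ord -[leLHS]mulr1.
by rewrite ler_wpM2l ?subr_ge0 //; have := dk fI; lra.
Qed.

(** Only the term of the heavy basis is kept. The constant [S^-1] is below all nonzero squared
    minors at once, so it does not depend on [x]. *)
Lemma nice_semistable (F : 'M[R]_(k, n)) : nice F -> semistable d F.
Proof.
move=> Fn; pose S := \sum_(f | minor F f != 0) (minor F f ^+ 2)^-1.
have Sf f : minor F f != 0 -> (minor F f ^+ 2)^-1 <= S.
  by move=> f0; rewrite /S (bigD1 f) //= lerDl sumr_ge0 // => g _; rewrite invr_ge0 sqr_ge0.
have S0 : 0 < S.
  have [f f0 _] := nice_heavy_basis 0 Fn.
  by apply: lt_le_trans (Sf f f0); rewrite invr_gt0 exprn_even_gt0.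
exists S^-1; first by rewrite invr_gt0.
move=> x; have [f f0 fx] := nice_heavy_basis x Fn.
rewrite /capacity /sumexp (bigD1 f) //=; apply: ler_wpDr.
  by apply: sumr_ge0 => g _; rewrite mulr_ge0 ?sqr_ge0 ?expR_ge0.
apply: ler_pM; rewrite ?invr_ge0 ?expR_ge0 ?(ltW S0) //.
  rewrite -[X in _ <= X]invrK lef_pV2 ?posrE ?invr_gt0 ?exprn_even_gt0 //.
  exact: Sf.
by rewrite dot_occ_row ler_expR.
Qed.

End nice_semistable.

(** * Paths of semistable matrices *)

Lemma cvg_mx (T : Type) (U : puniformType) k n (E : set_system T) (M : T ->
  'M[U]_(k, n)) (L : 'M[U]_(k, n)) :
  Filter E -> (forall i j, M x i j @[x --> E] --> L i j) -> M x @[x --> E] --> L.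
Proof.
move=> FE ML; apply/cvg_mx_entourageP => A entA.
apply: filter_forall => i; apply: filter_forall => j.
by have /(ML i j) : nbhs (L i j) (xsection A (L i j)) by exact: nbhs_entourage.
Qed.

(** Compact connected sets take the place of paths: concatenation is a union, and the uniform
    estimate on [K] and the intermediate value argument ask for nothing more. *)
Definition linked (T : topologicalType) (P : set T) (x y : T) :=
  exists K : set T, [/\ compact K, connected K, K x, K y & K `<=` P].

Lemma linked_sym (T : topologicalType) (P : set T) x y : linked P x y -> linked P y x.
Proof. by move=> [K [*]]; exists K; split. Qed.

Lemma linked_trans (T : topologicalType) (P : set T) y x z :
  linked P x y -> linked P y z -> linked P x z.
Proof.
move=> [K [cK nK Kx Ky KP]] [L [cL nL Ly Lz LP]]; exists (K `|` L); split.
- exact: compactU.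
- by apply: connectedU => //; exists y.
- by left.
- by right.
- by move=> w [/KP|/LP].
Qed.

Lemma linked_sub (T : topologicalType) (P Q : set T) x y : P `<=` Q -> linked P x y ->
  linked Q x y.
Proof. by move=> PQ [K [? ? ? ? KP]]; exists K; split => //; apply: subset_trans PQ. Qed.

Lemma linked_segment (R : realType) k n (P : set 'M[R]_(k, n)) F G :
  (forall t, 0 <= t <= 1 -> P ((1 - t) *: F + t *: G)) -> linked P F G.
Proof.
move=> FG; pose h (t : R) := (1 - t) *: F + t *: G.
have hc : continuous h.
  move=> t; apply: cvg_mx => i j.
  rewrite (_ : (fun x => h x i j) = fun x => (1 - x) * F i j + x * G i j); last first.
    by apply/funext => x; rewrite !mxE.
  rewrite !mxE; apply: cvgD; apply: cvgMl; last exact: cvg_id.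
  by apply: cvgB; [exact: cvg_cst | exact: cvg_id].
exists (h @` `[0, 1]%classic); split.
- by apply: continuous_compact; [exact: continuous_subspaceT | exact: segment_compact].
- by apply: connected_continuous_connected;
  [exact: segment_connected | exact: continuous_subspaceT].
- by exists 0; rewrite /h /= ?in_itv /= ?lexx ?ler01 // subr0 scale1r scale0r addr0.
- by exists 1; rewrite /h /= ?in_itv /= ?lexx ?ler01 // subrr scale0r scale1r add0r.
- by move=> _ /= [t t01 <-]; apply: FG; move: t01; rewrite /= in_itv.
Qed.

(** Split off the largest power of ['X]: the other factor is nonzero at 0, hence near 0. This serves
    to choose parameters that avoid finitely many degeneracies. *)
Lemma poly_neq0_near0 (R : realType) (p : {poly R}) : p != 0 ->
  exists2 e : R, 0 < e <= 1 & forall t, 0 < t <= e -> p.[t] != 0.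
Proof.
move=> p0; have [m [q]] := multiplicity_XsubC p 0; rewrite p0 /= => q0 ->.
have : \forall t \near (0 : R), q.[t] != 0.
  have /continuous_horner : nbhs q.[0] [set y | y != 0].
    by apply: open_nbhs_nbhs; split; [exact: open_neq | exact: q0].
  by [].
move/nbhs_ballP => [e /= e0 qe].
exists (Num.min (e / 2) 1) => [|t /andP[t0 te]].
  by rewrite lt_min divr_gt0 //= ltr01 ge_min lexx orbT.
rewrite hornerM mulf_neq0 //; last by rewrite horner_exp hornerXsubC subr0 expf_neq0 ?gt_eqF.
apply: qe; rewrite /ball /= sub0r normrN gtr0_norm //; apply: le_lt_trans te _.
by rewrite gt_min ltr_pdivrMr // ltr_pMr // ltr1n.
Qed.

Definition gen_pos (R : comNzRingType) k n (F : 'M[R]_(k, n)) :=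
  forall f : {ffun 'I_k -> 'I_n}, injective f -> minor F f != 0.

Lemma gen_pos_nice (R : comNzRingType) k n (F : 'M[R]_(k, n)) : gen_pos F -> nice F.
Proof. by move=> gF f i b fI _; left; apply: gF. Qed.

Definition set_col (R : Type) k n (F : 'M[R]_(k, n)) j (y : 'cV[R]_k) : 'M[R]_(k, n) :=
  \matrix_(i, l) if l == j then y i 0 else F i l.

Lemma set_col_id (R : Type) k n (F : 'M[R]_(k, n)) j : set_col F j (col j F) = F.
Proof. by apply/matrixP => i l; rewrite !mxE; case: eqP => // ->. Qed.

(** * Moving a single column between matrices in general position *)

Section column_move.
Variables (R : realType) (k n : nat) (F : 'M[R]_(k, n)) (j : 'I_n).
Implicit Types (y c : 'cV[R]_k) (f : {ffun 'I_k -> 'I_n}).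

Lemma minor_set_col f i1 y : injective f -> f i1 = j ->
  minor (set_col F j y) f = \sum_r y r 0 * cofactor (colsub f F) r i1.
Proof.
move=> fI fj; rewrite /minor (expand_det_col _ i1); apply: eq_bigr => r _.
rewrite !mxE fj eqxx; congr (_ * (_ * \det _)); apply/matrixP => u v; rewrite !mxE.
by rewrite -fj (inj_eq fI) eq_sym (negPf (neq_lift _ _)).
Qed.

Lemma minor_set_col_out f y : j \notin codom f -> minor (set_col F j y) f = minor F f.
Proof.
move=> jf; congr (\det _); apply/matrixP => r i; rewrite !mxE.
by case: eqP => // fj; case/negP: jf; rewrite -fj codom_f.
Qed.

Hypothesis gF : gen_pos F.

(* The value at [(1, s, ..., s^(k-1))] of the linear form that vanishes at a
   column [c] when the segment from [y] to [c] may cross the zero sets of both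
   minors at once. *)
Let sep y f i b i1 : {poly R} :=
  \poly_(r < k) (minor (set_col F j y) f * (cofactor (colsub (upd f i b) F))  (insubd i1 r) i1
    - minor (set_col F j y) (upd f i b) * (cofactor (colsub f F)) (insubd i1 r) i1).

(** The moment curve: a linear form restricted to it becomes the polynomial with the same
    coefficients, so a nonzero form stays nonzero. *)
Let curve s : 'cV[R]_k := \col_r s ^+ r.

Let sepE y f i b i1 s : injective f -> b \notin codom f -> f i1 = j -> i1 != i ->
  (sep y f i b i1).[s] =
  minor (set_col F j y) f * minor (set_col F j (curve s)) (upd f i b)
  - minor (set_col F j y) (upd f i b) * minor (set_col F j (curve s)) f.
Proof.
move=> fI bf fj ii1; rewrite horner_poly (minor_set_col (curve s) fI fj).
rewrite (@minor_set_col (upd f i b) i1 (curve s)) ?ffunE ?(negPf ii1) //; last exact: upd_inj.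
rewrite !big_distrr -sumrB; apply: eq_bigr => r _; rewrite mxE /= /insubd valK /=; ring.
Qed.

(** If the form vanished, evaluate it at column [b] of [F]. There the minor at [upd f i b] has two
    equal columns and is 0, while the other term is a product of two minors that general position
    makes nonzero. *)
Let sep_neq0 y f i b i1 : gen_pos (set_col F j y) ->
  injective f -> b \notin codom f -> f i1 = j -> i1 != i -> sep y f i b i1 != 0.
Proof.
move=> gy fI bf fj ii1; apply/eqP => /polyP s0.
have bj : b != j by apply: contraNneq bf => ->; rewrite -fj codom_f.
have : minor (set_col F j y) f * minor (set_col F j (col b F)) (upd f i b)
  = minor (set_col F j y) (upd f i b) * minor (set_col F j (col b F)) f.
  apply/eqP; rewrite -subr_eq0 (minor_set_col (col b F) fI fj).
  rewrite (@minor_set_col (upd f i b) i1) ?ffunE ?(negPf ii1) //; last exact: upd_inj.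
  rewrite !big_distrr -sumrB big1 // => r _.
  have := s0 r; rewrite coef_poly ltn_ord coef0 /insubd valK /= => h.
  by rewrite mulrCA [X in _ - X]mulrCA -mulrBr h mulr0.
have -> : minor (set_col F j (col b F)) (upd f i b) = 0.
  apply: (minor_eq0 ii1); apply/colP => r.
  by rewrite !mxE !ffunE eqxx (negPf ii1) fj eqxx (negPf bj).
rewrite mulr0 => /esym/eqP; rewrite mulf_eq0 (negPf (gy _ (upd_inj fI bf))) /=.
have -> : minor (set_col F j (col b F)) f = minor F (upd f i1 b).
  congr (\det _); apply/matrixP => r u; rewrite !mxE ffunE -fj (inj_eq fI).
  by case: eqP => _; rewrite ?mxE.
by apply/negP/gF/upd_inj.
Qed.

(** A minor that avoids column [j] is that of [F], hence nonzero. If both minors use column [j],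
    both are affine in [t], and [sep] at [s] is the determinant of their endpoint values. *)
Let nice_segment y s :
  gen_pos (set_col F j y) ->
  (forall f i b i1, injective f -> b \notin codom f -> f i1 = j -> i1 != i ->
    (sep y f i b i1).[s] != 0) ->
  forall t, 0 <= t <= 1 -> nice ((1 - t) *: set_col F j y + t *: set_col F j (curve s)).
Proof.
move=> gy sP t t01 f i b fI bf.
have -> : (1 - t) *: set_col F j y + t *: set_col F j (curve s) =
          set_col F j ((1 - t) *: y + t *: curve s).
  by apply/matrixP => u v; rewrite !mxE; case: eqP => // _; ring.
have [/codomP[i1 /esym fj]|jf] := boolP (j \in codom f); last first.
  by left; rewrite minor_set_col_out ?gF.
have [jg|jg] := boolP (j \in codom (upd f i b)); last first.
  by right; rewrite minor_set_col_out ?gF //; exact: upd_inj.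
have ii1 : i1 != i.
  apply: contraTneq jg => ii1; apply/negP => /codomP[u]; rewrite ffunE.
  case: eqP => [_ jb|ui]; first by case/negP: bf; rewrite -jb -fj codom_f.
  by rewrite -fj => /fI; rewrite ii1 => iu; apply: ui.
have gI := upd_inj fI bf.
have gj : upd f i b i1 = j by rewrite ffunE (negPf ii1).
have lin (g : {ffun 'I_k -> 'I_n}) : injective g -> g i1 = j ->
  minor (set_col F j ((1 - t) *: y + t *: curve s)) g =
    (1 - t) * minor (set_col F j y) g + t * minor (set_col F j (curve s)) g.
  move=> hI hj; rewrite !(minor_set_col _ hI hj) !mulr_sumr -big_split /=.
  by apply: eq_bigr => r _; rewrite !mxE; ring.
(* A common zero would force [t = 0], where the minor at [f] is nonzero by [gy]. *)
apply/orP; rewrite -negb_and; apply/negP => /andP[/eqP E1 /eqP E2].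
move: E1 E2; rewrite !lin //.
have := sP f i b i1 fI bf fj ii1; rewrite sepE //.
have := gy f fI.
set l := minor (set_col F j y) f; set l' := minor (set_col F j y) (upd f i b).
set m := minor (set_col F j (curve s)) f; set m' := minor (set_col F j (curve s)) (upd f i b).
move=> l0 D0 E1 E2.
have /eqP : t * (l * m' - l' * m) = 0.
  have -> : t * (l * m' - l' * m) = l * ((1 - t) * l' + t * m') - l' * ((1 - t) * l + t *
    m) by ring.
  by rewrite E1 E2 !mulr0 subrr.
rewrite mulf_eq0 (negPf D0) orbF => /eqP tz.
by move: E1 l0; rewrite tz subr0 mul1r mul0r addr0 => ->; rewrite eqxx.
Qed.

(** Two segments through the column [curve s], with one [s] that suits both the old column and the
    new one. *)
Lemma linked_set_col y : gen_pos (set_col F j y) -> linked (@nice R k n) F (set_col F j y).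
Proof.
move=> gy; pose I := ({ffun 'I_k -> 'I_n} * 'I_k * ('I_n * 'I_k))%type.
pose ok (x : I) := [&& injectiveb x.1.1, x.2.1 \notin codom x.1.1,
  x.1.1 x.2.2 == j & x.2.2 != x.1.2].
pose q z := \prod_(x : I | ok x) sep z x.1.1 x.1.2 x.2.1 x.2.2.
have q0 z : gen_pos (set_col F j z) -> q z != 0.
  by move=> gz; apply/prodf_neq0 => x /and4P[/injectiveP fI bf /eqP fj ii]; apply: sep_neq0.
have gF' : gen_pos (set_col F j (col j F)) by rewrite set_col_id.
have [s s01 /(_ s)] := poly_neq0_near0 (mulf_neq0 (q0 _ gF') (q0 _ gy)).
have [s0 _] := andP s01; rewrite s0 lexx hornerM mulf_eq0 negb_or => /(_ isT) /andP[qF qy].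
have qP z f i b i1 : (q z).[s] != 0 -> injective f -> b \notin codom f -> f i1 = j ->
  i1 != i ->
    (sep z f i b i1).[s] != 0.
  rewrite horner_prod => /prodf_neq0 h fI bf fj ii; apply: (h (f, i, (b, i1))).
  by rewrite /ok /= fj eqxx ii bf !andbT; apply/injectiveP.
apply: (linked_trans (y := set_col F j (curve s))).
  rewrite -{1}(set_col_id F j); apply: linked_segment; apply: nice_segment => // *; exact: qP.
apply/linked_sym/linked_segment; apply: nice_segment => // *; exact: qP.
Qed.

End column_move.

(** A Vandermonde matrix with nodes 0, ..., n - 1: a fixed matrix in general position to which every
    frame gets linked. *)
Definition vdm (R : pzRingType) k n : 'M[R]_(k, n) := \matrix_(i, j) (j%:R ^+ i).

Lemma gen_pos_vdm (R : realType) k n : gen_pos (vdm R k n).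
Proof.
move=> f fI; have -> : minor (vdm R k n) f = \det (Vandermonde k (\row_i (f i)%:R : 'rV[R]_k)).
  by congr (\det _); apply/matrixP => r i; rewrite !mxE.
rewrite det_Vandermonde; apply/prodf_neq0 => i _; apply/prodf_neq0 => i' ii'.
rewrite !mxE subr_eq0 eqr_nat; apply/eqP => /val_inj /fI E.
by rewrite E ltnn in ii'.
Qed.

Section to_vdm.
Variables (R : realType) (k n : nat) (F : 'M[R]_(k, n)).
Let G := vdm R k n.

Let mixed m (t : R) : 'M[R]_(k, n) :=
  \matrix_(i, j) if (j < m)%N then G i j else (1 - t) * F i j + t * G i j.

Let mixed_poly (m : nat) (f : {ffun 'I_k -> 'I_n}) : {poly R} :=
  \det (colsub f (\matrix_(i, j) if (j < m)%N then (G i j)%:P else (1 - 'X) * (F i j)%:P +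
    'X * (G i j)%:P)).

Let mixed_polyE m f t : (mixed_poly m f).[t] = minor (mixed m t) f.
Proof.
rewrite -horner_evalE /mixed_poly -det_map_mx; congr (\det _); apply/matrixP => i j;
  rewrite !mxE.
by case: ifP => _; rewrite /= horner_evalE !hornerE.
Qed.

(** First [F] is moved a little along the segment towards [vdm R k n], then the columns are replaced
    one at a time. [F] itself need not be nice, hence the assumption [P F] for the starting
    point. *)
Lemma linked_vdm (P : set 'M[R]_(k, n)) : P F -> @nice R k n `<=` P -> linked P F (vdm R k n).
Proof.
move=> PF nP.
(* All minors of all the stages [mixed m] are polynomials in [t], nonzero at [t = 1]; a single [e]
   near 0 therefore serves them all. *)
pose q := \prod_(m < n.+1) \prod_(f : {ffun 'I_k -> 'I_n} | injectiveb f) mixed_poly m f.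
have q0 : q != 0.
  apply/prodf_neq0 => m _; apply/prodf_neq0 => f /injectiveP fI.
  apply: contra_neq (@gen_pos_vdm R k n f fI) => pm.
  have <- : mixed m 1 = vdm R k n.
    by apply/matrixP => i j; rewrite !mxE; case: ifP => // _; rewrite subrr mul0r add0r mul1r.
  by rewrite -mixed_polyE pm horner0.
have [e /andP[e0 e1] qe] := poly_neq0_near0 q0.
have gm m t : (m <= n)%N -> 0 < t <= e -> gen_pos (mixed m t).
  rewrite -ltnS => mn /qe; rewrite horner_prod => /prodf_neq0/(_ (Ordinal mn) isT).
  rewrite horner_prod => /prodf_neq0 h f /injectiveP fI.
  by rewrite -mixed_polyE; apply: h.
have m0 t : mixed 0 t = (1 - t) *: F + t *: G by apply/matrixP => i j; rewrite !mxE.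
apply: (linked_trans (y := mixed 0 e)).
  apply: linked_segment => t /andP[t0 t1].
  have -> : (1 - t) *: F + t *: mixed 0 e = mixed 0 (t * e).
    by rewrite !m0; apply/matrixP => i j; rewrite !mxE; ring.
  have [->|tn0] := eqVneq t 0; first by rewrite mul0r m0 subr0 scale1r scale0r addr0.
  have tg : 0 < t by rewrite lt0r tn0.
  by apply/nP/gen_pos_nice/gm => //; rewrite mulr_gt0 //= ger_pMl.
apply: (linked_sub nP).
have -> : vdm R k n = mixed n e by apply/matrixP => i j; rewrite !mxE ltn_ord.
have H m : (m <= n)%N -> linked (@nice R k n) (mixed 0 e) (mixed m e); last exact: H.
elim: m => [_|m IH mn].
  apply: linked_segment => t _; rewrite -scalerDl subrK scale1r.
  by apply/gen_pos_nice/gm; rewrite ?e0 ?lexx.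
apply: linked_trans (IH (ltnW mn)) _.
have E : mixed m.+1 e = set_col (mixed m e) (Ordinal mn) (col (Ordinal mn) G).
  apply/matrixP => i j; rewrite !mxE ltnS leq_eqVlt -[j == _]/(val j == m).
  by case: eqP => [jm|_] //=; congr (_ ^+ _); rewrite jm.
rewrite E; apply: linked_set_col.
  by apply: gm; rewrite ?e0 ?lexx // ltnW.
by rewrite -E; apply: gm; rewrite ?e0 ?lexx.
Qed.

End to_vdm.

(** * Scaling to a Parseval frame *)

Section cvg_finite.
Variables (R : realType) (T : Type) (E : set_system T).
Context {FE : Filter E}.

Lemma cvg_fsum (I : Type) (s : seq I) (u : I -> T -> R) (l : I -> R) :
  (forall i, u i x @[x --> E] --> l i) ->
  (\sum_(i <- s) u i x) @[x --> E] --> \sum_(i <- s) l i.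
Proof.
move=> ul; elim: s => [|i s IH].
  by rewrite big_nil; under eq_fun do rewrite big_nil; exact: cvg_cst.
by rewrite big_cons; under eq_fun do rewrite big_cons; exact: cvgD.
Qed.

Lemma cvg_fprod (I : Type) (s : seq I) (u : I -> T -> R) (l : I -> R) :
  (forall i, u i x @[x --> E] --> l i) ->
  (\prod_(i <- s) u i x) @[x --> E] --> \prod_(i <- s) l i.
Proof.
move=> ul; elim: s => [|i s IH].
  by rewrite big_nil; under eq_fun do rewrite big_nil; exact: cvg_cst.
by rewrite big_cons; under eq_fun do rewrite big_cons; exact: cvgM.
Qed.

Lemma cvg_gs k n (A : T -> 'M[R]_(k, n)) (L : 'M[R]_(k, n)) : row_free L ->
  (forall i j, A x i j @[x --> E] --> L i j) ->
  forall i j, gs (A x) i j @[x --> E] --> gs L i j.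
Proof.
elim: k A L => [|k IH] A L Lf AL i j; first by case: i.
have [GG _] := gs_spec Lf; move: GG.
have {}IH := IH (fun x => dsubmx (A x : 'M[R]_(1 + k,
  n))) _ (row_free_dsubmx (Lf : row_free (L : 'M[R]_(1 + k, n)))).
have {}IH a b : gs (dsubmx (A x : 'M[R]_(1 + k, n))) a b @[x --> E] -->
  gs (dsubmx (L : 'M[R]_(1 + k, n))) a b.
  apply: IH => u v; rewrite mxE; under eq_fun do rewrite mxE; exact: AL.
rewrite /=.
pose v (M : 'M[R]_(k.+1, n)) := usubmx (M : 'M[R]_(1 + k, n)) -
  usubmx (M : 'M[R]_(1 + k, n)) *m (gs (dsubmx (M : 'M[R]_(1 + k,
    n))))^T *m gs (dsubmx (M : 'M[R]_(1 + k, n))).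
rewrite -/(v L); under eq_fun do rewrite -/(v _).
have us b : usubmx (A x : 'M[R]_(1 + k, n)) 0 b @[x --> E] -->
  usubmx (L : 'M[R]_(1 + k, n)) 0 b.
  by rewrite mxE; under eq_fun do rewrite mxE; exact: AL.
have vc b : v (A x) 0 b @[x --> E] --> v L 0 b.
  rewrite /v !mxE; under eq_fun do rewrite !mxE.
  apply: cvgB; first exact: AL.
  apply: cvg_fsum => c; apply: cvgM; last exact: IH.
  rewrite !mxE; under eq_fun do rewrite !mxE.
  apply: cvg_fsum => e; rewrite !mxE; under eq_fun do rewrite !mxE.
  by apply: cvgM; [exact: AL | exact: IH].
clearbody v.
have nc : (v (A x) *m (v (A x))^T) 0 0 @[x --> E] --> (v L *m (v L)^T) 0 0.
  rewrite !mxE; under eq_fun do rewrite !mxE.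
  apply: cvg_fsum => c; rewrite !mxE; under eq_fun do rewrite !mxE.
  by apply: cvgM.
(* If this norm were 0, its inverse would be 0 too and [gs L] would have a zero row, against
   [GG]. *)
move=> GG; have v0 : Num.sqrt ((v L *m (v L)^T) 0 0) != 0.
  have : col_mx ((Num.sqrt ((v L *m (v L)^T) 0 0))^-1 *: v L) (gs (dsubmx (L : 'M[R]_(1 +
    k, n)))) *m
    (col_mx ((Num.sqrt ((v L *m (v L)^T) 0 0))^-1 *: v L) (gs (dsubmx (L : 'M[R]_(1 + k,
      n)))))^T = 1%:M by [].
  apply: contra_eq_neq => ->; rewrite invr0 scale0r; apply/eqP.
  rewrite tr_col_mx mul_col_row (scalar_mx_block _ _ 1) mul0mx =>
    /eq_block_mx[/matrixP/(_ 0 0)].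
  by rewrite !mxE => /eqP; rewrite eq_sym oner_eq0.
have ac : (Num.sqrt ((v (A x) *m (v (A x))^T) 0 0))^-1 @[x --> E] -->
  (Num.sqrt ((v L *m (v L)^T) 0 0))^-1.
  apply: cvgV => //; by apply: continuous_cvg; first exact: sqrt_continuous.
suff : forall i : 'I_(1 + k),
    col_mx ((Num.sqrt ((v (A x) *m (v (A x))^T) 0 0))^-1 *: v (A x))
      (gs (dsubmx (A x : 'M[R]_(1 + k, n)))) i j @[x --> E] -->
    col_mx ((Num.sqrt ((v L *m (v L)^T) 0 0))^-1 *: v L)
      (gs (dsubmx (L : 'M[R]_(1 + k, n)))) i j by apply.
move=> {}i; case: (split_ordP i) => i' ->.
  rewrite col_mxEu mxE; under eq_fun do rewrite col_mxEu mxE.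
  by rewrite (ord1 i'); apply: cvgM.
rewrite col_mxEd; under eq_fun do rewrite col_mxEd; exact: IH.
Qed.

End cvg_finite.

Lemma minor_row_free (K : fieldType) k n (F : 'M[K]_(k, n)) f : minor F f != 0 -> row_free F.
Proof.
rewrite /minor -unitfE -[_ \is a _]/(colsub f F \in unitmx) => Fu.
apply/row_freeP; exists ((colsub f 1%:M : 'M[K]_(n, k)) *m invmx (colsub f F)).
by rewrite mulmxA mulmx_colsub mulmx1 mulmxV.
Qed.

Section scaling.
Variables (R : realType) (k n : nat) (d : 'rV[R]_n).
Implicit Types F : 'M[R]_(k, n).

Let w F (f : {ffun 'I_k -> 'I_n}) := minor F f ^+ 2.
Let wge0 F f : 0 <= w F f. Proof. exact: sqr_ge0. Qed.

(** The leverage scores of the rescaled matrix, that is, its squared column norms once the rows are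
    orthonormalized; see [balance_sqnorm]. *)
Definition leverage F x := mean (@occ_row R k n) (w F) x.
Definition scaling N F := iter N (descent (@occ_row R k n) d (w F)) 0.
Definition residual N F := sqn (leverage F (scaling N F) - d).
(** Half exponents, because [capacity] weighs the squares of the minors. *)
Definition balance N F := gs (F *m diag_mx (\row_j expR (scaling N F 0 j / 2))).

Lemma capacity0 F : capacity F 0 = \sum_f w F f.
Proof.
apply: eq_bigr => f _; rewrite -(scale0r (0 : 'rV[R]_n)) dotZr mul0r expR0 mulr1 //.
Qed.

Section one_frame.
Variable F : 'M[R]_(k, n).
Hypothesis F0 : 0 < \sum_f w F f.

Lemma row_free_scaled (y : 'rV[R]_n) : (forall j, 0 < y 0 j) -> row_free (F *m diag_mx y).
Proof.
move=> y0; have [f f0|w0] := pickP [pred f | minor F f != 0]; last first.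
  by move: F0; rewrite big1 ?ltxx // => f _; have /negbFE/eqP := w0 f; rewrite /w => ->;
    rewrite expr0n.
apply: (@minor_row_free _ _ _ _ f); rewrite -[F]mul1mx minor_mul_diag det1 mul1r mulf_neq0 //.
by apply/prodf_neq0 => i _; rewrite gt_eqF.
Qed.

Lemma balance_orth N : balance N F *m (balance N F)^T = 1%:M.
Proof.
by apply: (gs_spec (row_free_scaled _)).1 => j; rewrite mxE expR_gt0.
Qed.

(** Orthonormalization multiplies all minors by one factor [\det L], which cancels when
    [sum_sqr_minor_occ] is divided by [sum_sqr_minor]. *)
Lemma balance_sqnorm N j : \sum_i balance N F i j ^+ 2 = leverage F (scaling N F) 0 j.
Proof.
set x := scaling N F; set y : 'rV_n := \row_j expR (x 0 j / 2).
have y0 l : 0 < y 0 l by rewrite mxE expR_gt0.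
have [QQ [L Lu QE]] := gs_spec (row_free_scaled y0).
have mE f : minor (gs (F *m diag_mx y)) f ^+ 2 = \det L ^+ 2 * (w F f * expR (dot (occ_row
  R f) x)).
  rewrite QE mulmxA minor_mul_diag !exprMn -mulrA; congr (_ * (_ * _)).
  rewrite dot_occ_row expR_sum -prodrXl; apply: eq_bigr => i _.
  by rewrite mxE expr2 -expRD -splitr.
have := sum_sqr_minor_occ QQ j; rewrite -(sum_sqr_minor QQ).
under eq_bigr do rewrite mE; under [in X in _ = X -> _]eq_bigr do rewrite mE.
under eq_bigr do rewrite -mulrA; rewrite -!mulr_sumr -mulrA => /mulfI.
rewrite expf_neq0 -?unitfE // => /(_ isT).
rewrite -[\sum_i gs _ i j ^+ 2]/(\sum_i balance N F i j ^+ 2) => e.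
have Z0 := sumexp_gt0 (@occ_row R k n) (wge0 F) F0 x.
rewrite mxE; apply: (mulfI (lt0r_neq0 Z0)); rewrite [RHS]mulrC divfK ?gt_eqF // -e.
by apply: eq_bigr => f _; rewrite mxE.
Qed.

End one_frame.

Lemma parseval_leverage F : F *m F^T = 1%:M -> leverage F 0 = \row_j \sum_i F i j ^+ 2.
Proof.
move=> FF; apply/rowP => j; rewrite !mxE -/(capacity F 0) capacity0 (sum_sqr_minor FF).
apply: (mulfI (_ : k`!%:R != 0 :> R)); first by rewrite pnatr_eq0 -lt0n fact_gt0.
rewrite [LHS]mulrC divfK ?pnatr_eq0 -?lt0n ?fact_gt0 // -(sum_sqr_minor_occ FF).
by apply: eq_bigr => f _; rewrite mxE -(scale0r (0 : 'rV[R]_n)) dotZr mul0r expR0 mulr1.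
Qed.

(** On a frame the gradient vanishes at the starting point 0, so descent stays there, and
    Gram-Schmidt fixes orthonormal rows. *)
Lemma balance_frame N F : F *m F^T = 1%:M -> (forall j, \sum_i F i j ^+ 2 = d 0 j) ->
  balance N F = F.
Proof.
move=> FF Fd; have x0 : scaling N F = 0.
  elim: N => // N IH; rewrite /scaling iterS -/(scaling N F) IH /descent -/(leverage F 0)
    parseval_leverage //.
  by apply/rowP => j; rewrite !mxE Fd subrr mulr0 subr0.
rewrite /balance x0 (_ : diag_mx _ = 1%:M) ?mulmx1 ?gs_id //.
by apply/matrixP => i j; rewrite !mxE mul0r expR0.
Qed.

Lemma semistable_sum_gt0 F : semistable d F -> 0 < \sum_f w F f.
Proof.
move=> [C C0 /(_ 0)]; rewrite capacity0 -(scale0r (0 : 'rV[R]_n)) dotZr mul0r expR0 mulr1.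
exact: lt_le_trans.
Qed.

Lemma residualE N F :
  residual N F = \sum_j (leverage F (scaling N F) 0 j - d 0 j) ^+ 2.
Proof. by apply: eq_bigr => j _; rewrite mxE [in X in _ + X]mxE expr2. Qed.

Lemma residual_anti F M N : 0 < \sum_f w F f -> (M <= N)%N -> residual N F <= residual M F.
Proof.
move=> F0 /subnK <-; elim: (N - M)%N => // m IH; apply: le_trans IH.
by rewrite addSn /residual /scaling iterS; exact: sqn_grad_descent.
Qed.

Lemma residual_small F e : semistable d F -> 0 < e -> exists N, residual N F < e.
Proof.
move=> Fs e0; have F0 := semistable_sum_gt0 Fs; have [C C0 Cle] := Fs.
have lnC x : ln C + dot d x <= ln (sumexp (@occ_row R k n) (w F) x).
  rewrite -[X in _ + X]expRK -lnM ?posrE ?expR_gt0 //.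
  by rewrite ler_ln ?posrE ?mulr_gt0 ?expR_gt0 ?sumexp_gt0 //; exact: Cle.
set B := ln (sumexp (@occ_row R k n) (w F) 0) - ln C.
set s : R := stepsize (@occ_row R k n) d / 2.
have s0 : 0 < s by rewrite divr_gt0 // stepsize_gt0.
pose N := (Num.truncn (B / (s * e))).+1; exists N; rewrite ltNge; apply/negP => eN.
have := iter_descent_residual (wge0 F) F0 N lnC;
  rewrite -/(scaling N F) -/(leverage F _) -/(residual N F) -/s -/B.
apply/negP; rewrite -ltNge; apply: (@lt_le_trans _ _ (N%:R * (s * e))); last first.
  by rewrite ler_wpM2l // ler_wpM2l // ltW.
by rewrite -ltr_pdivrMr ?(mulr_gt0 s0 e0) //; exact: truncnS_gt.
Qed.

(** * Continuity of the balancing map for a fixed number of steps *)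

Section continuity.
Variables (T : Type) (E : set_system T).
Context {FE : Filter E}.
Variables (M : T -> 'M[R]_(k, n)) (F : 'M[R]_(k, n)).
Hypothesis MF : forall i j, M t i j @[t --> E] --> F i j.

Let cvg_w f : w (M t) f @[t --> E] --> w F f.
Proof.
have mc : minor (M t) f @[t --> E] --> minor F f.
  rewrite /minor /determinant; apply: cvg_fsum => s; apply: cvgM; first exact: cvg_cst.
  apply: cvg_fprod => i; rewrite mxE; under eq_fun do rewrite mxE.
  exact: MF.
exact: (cvgM mc mc).
Qed.

Lemma cvg_sum_minor : (\sum_f w (M t) f) @[t --> E] --> \sum_f w F f.
Proof. exact: cvg_fsum. Qed.

Hypothesis F0 : 0 < \sum_f w F f.

Let cvg_leverage (x : T -> 'rV[R]_n) (y : 'rV[R]_n) j :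
  (forall j, x t 0 j @[t --> E] --> y 0 j) ->
  leverage (M t) (x t) 0 j @[t --> E] --> leverage F y 0 j.
Proof.
move=> xc; have ec f : (w (M t) f * expR (dot (occ_row R f) (x t))) @[t --> E] -->
    w F f * expR (dot (occ_row R f) y).
  apply: cvgM; first exact: cvg_w.
  apply: continuous_cvg; first exact: continuous_expR.
  by rewrite /dot; apply: cvg_fsum => l; apply: cvgM => //; exact: cvg_cst.
rewrite mxE; under eq_fun do rewrite mxE; apply: cvgM.
  by apply: cvg_fsum => f; apply: cvgM => //; exact: cvg_cst.
apply: cvgV; first by rewrite gt_eqF ?sumexp_gt0.
exact: cvg_fsum.
Qed.

Let cvg_scaling N j : scaling N (M t) 0 j @[t --> E] --> scaling N F 0 j.
Proof.
elim: N j => [|N IH] j; first exact: cvg_cst.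
pose u G := scaling N G 0 j -
  stepsize (@occ_row R k n) d * (leverage G (scaling N G) 0 j - d 0 j).
have uE : (fun G => scaling N.+1 G 0 j) = u.
  by apply/funext => G; rewrite /u {1}/scaling iterS -/(scaling N G) !mxE.
suff : u (M t) @[t --> E] --> u F by rewrite -uE.
apply: cvgB; first exact: IH.
apply: cvgM; first exact: cvg_cst.
by apply: cvgB; [exact: cvg_leverage | exact: cvg_cst].
Qed.

Lemma cvg_residual N : residual N (M t) @[t --> E] --> residual N F.
Proof.
pose u G := \sum_j (leverage G (scaling N G) 0 j - d 0 j) ^+ 2.
suff : u (M t) @[t --> E] --> u F.
  by have -> : u = residual N by apply/funext => G; rewrite residualE.
apply: cvg_fsum => j.
have gc : (leverage (M t) (scaling N (M t)) 0 j - d 0 j) @[t --> E] -->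
    leverage F (scaling N F) 0 j - d 0 j.
  apply: cvgB; last exact: cvg_cst.
  by apply: cvg_leverage => l; exact: cvg_scaling.
exact: (cvgM gc gc).
Qed.

Lemma cvg_balance N : balance N (M t) @[t --> E] --> balance N F.
Proof.
apply: cvg_mx => i j; apply: cvg_gs => [|{}i {}j].
  by apply: row_free_scaled => // l; rewrite mxE expR_gt0.
rewrite mul_mx_diag !mxE; under eq_fun do rewrite mul_mx_diag !mxE.
apply: cvgM; first exact: MF.
apply: continuous_cvg; first exact: continuous_expR.
by apply: cvgM; [exact: cvg_scaling | exact: cvg_cst].
Qed.

End continuity.

(** Dini's argument: the residuals are continuous, decrease with [N] and become small at each point,
    hence do so uniformly on a compact set. *)
Lemma residual_uniform K e : compact K -> K `<=` semistable d -> 0 < e ->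
  exists N, forall F, K F -> residual N F < e.
Proof.
move=> /compact_near_coveringP cK Ks e0.
have [N _ NK] : \forall N \near \oo, K `<=` (fun F => residual N F < e); last first.
  by exists N => F; apply: NK => /=.
apply: cK => F /Ks Fs; have F0 := semistable_sum_gt0 Fs; have [N Ne] := residual_small Fs e0.
have nF : \forall F' \near F, residual N F' < e.
  have rc : residual N F' @[F' --> F] -->
    residual N F by apply: (@cvg_residual _ (nbhs F) _ id) => // i j; exact: coord_continuous.
  by have /rc : nbhs (residual N F) [set y | y < e] by exact: lt_nbhsl.
(* Monotonicity in [N] is required at the neighbours [F'] as well, so their minors must not all
   vanish. *)
have nF0 : \forall F' \near F, 0 < \sum_f w F' f.
  have wc : (\sum_f w F' f) @[F' --> F] -->
    \sum_f w F f by apply: (@cvg_sum_minor _ (nbhs F) _ id) => i j; exact: coord_continuous.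
  by have /wc : nbhs (\sum_f w F f) [set y | 0 < y] by exact: lt_nbhsr.
exists ([set F' | residual N F' < e] `&` [set F' | 0 < \sum_f w F' f], [set M | (N <= M)%N]).
  by split; [exact: filterI | exists N].
by move=> [F' M] [[/= rF' F'0] NM]; apply: le_lt_trans rF'; exact: residual_anti.
Qed.

End scaling.

(** * Connectedness *)

Section compactness.
Variables (R : realType) (k n : nat).

Lemma closed_forall_eq (T : topologicalType) (I : Type) (u : I -> T -> R) (c : I -> R) :
  (forall i, continuous (u i)) -> closed [set x | forall i, u i x = c i].
Proof.
move=> uc; have -> : [set x | forall i,
  u i x = c i] = \bigcap_(i in setT) (u i @^-1` [set c i]).
  by apply/seteqP; split => x h i; [move=> _; exact: h | exact: h].
by apply: closed_bigI => i _; apply: closed_comp => // x _; exact: uc.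
Qed.

Lemma compact_box : compact [set F : 'M[R]_(k, n) | forall i j, `[-1, 1]%classic (F i j)].
Proof.
have -> : [set F : 'M[R]_(k, n) | forall i j, `[-1, 1]%classic (F i j)] =
    vec_mx @` [set v : 'rV[R]_(k * n) | forall l, `[-1, 1]%classic (v ord0 l)].
  apply/seteqP; split => F.
    move=> h; exists (mxvec F); last exact: mxvecK.
    by move=> l; case/mxvec_indexP: l => i j; rewrite mxvecE; exact: h.
  by move=> [v h <-] i j; rewrite mxE; exact: h.
apply: continuous_compact; last first.
  exact: (@rV_compact R _ (fun=> `[-1, 1]%classic) (fun=> @segment_compact _ _ _)).
apply: continuous_subspaceT => v; apply: (@cvg_mx _ _ _ _ (nbhs v)) => i j.
rewrite mxE; under eq_fun do rewrite mxE; exact: coord_continuous.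
Qed.

Lemma closed_parseval : closed [set F : 'M[R]_(k, n) | F *m F^T = 1%:M].
Proof.
have -> : [set F : 'M[R]_(k, n) | F *m F^T = 1%:M] =
    [set F : 'M[R]_(k, n) | forall ij, (F *m F^T) ij.1 ij.2 = (1%:M : 'M[R]_k) ij.1 ij.2].
  apply/seteqP; split => F /= h; first by rewrite h.
  by apply/matrixP => i j; exact: (h (i, j)).
apply: closed_forall_eq => -[i j];
  rewrite (_ : (fun F : 'M[R]_(k, n) => _) = fun F : 'M[R]_(k, n) => \sum_l F i l * F j l).
  move=> F; apply: (@cvg_fsum _ _ (nbhs F)) => l.
  by apply: (@cvgM _ _ (nbhs F)); exact: coord_continuous.
by apply/funext => F; rewrite mxE; apply: eq_bigr => l _; rewrite mxE.
Qed.

Lemma compact_parseval : compact [set F : 'M[R]_(k, n) | F *m F^T = 1%:M].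
Proof.
apply: subclosed_compact closed_parseval compact_box _ => F /= FF i j.
have : F i j ^+ 2 <= 1.
  have <- : (F *m F^T) i i = 1 by rewrite FF mxE eqxx.
  rewrite mxE (bigD1 j) //= mxE expr2 lerDl sumr_ge0 // => l _; rewrite mxE -expr2;
    exact: sqr_ge0.
by rewrite in_itv /= -ler_norml -[in X in _ -> X](@expr_le1 _ 2) // real_normK ?num_real.
Qed.

Lemma continuous_col_sqnorm j : continuous (fun F : 'M[R]_(k, n) => col_sqnorm F j).
Proof.
move=> F; apply: (@cvg_fsum _ _ (nbhs F)) => i.
by rewrite expr2; under eq_fun do rewrite expr2; apply: (@cvgM _ _ (nbhs F));
  exact: coord_continuous.
Qed.

Lemma closed_frames (d : 'rV[R]_n) : closed (frames k d).
Proof.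
have -> : frames k d = [set F : 'M[R]_(k, n) | F *m F^T = 1%:M] `&`
    [set F : 'M[R]_(k, n) | forall j, col_sqnorm F j = d 0 j] by [].
by apply: closedI; [exact: closed_parseval | apply: closed_forall_eq;
  exact: continuous_col_sqnorm].
Qed.

(** [B] is compact, so the error has a compact image; this image misses 0, hence a whole
    neighbourhood of 0. *)
Lemma norm_error_bounded_below (d : 'rV[R]_n) (B : set 'M[R]_(k, n)) : closed B ->
  (forall F, B F -> F *m F^T = 1%:M) -> (forall F, B F -> ~ frames k d F) ->
  exists2 e : R, 0 < e & forall F, B F -> e <= \sum_j (col_sqnorm F j - d 0 j) ^+ 2.
Proof.
move=> Bc BF Bd; pose r (F : 'M[R]_(k, n)) := \sum_j (col_sqnorm F j - d 0 j) ^+ 2.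
have rc : continuous r.
  move=> F; apply: (@cvg_fsum _ _ (nbhs F)) => j.
  rewrite expr2; under eq_fun do rewrite expr2.
  have dc : (col_sqnorm G j - d 0 j) @[G --> F] --> col_sqnorm F j - d 0 j.
    by apply: (@cvgB _ _ _ (nbhs F)); [exact: continuous_col_sqnorm | exact: cvg_cst].
  exact: (cvgM dc dc).
have cB : compact B by apply: subclosed_compact Bc compact_parseval _.
have crB : closed (r @` B).
  apply: compact_closed; first exact: Rhausdorff.
  by apply: continuous_compact => //; exact: continuous_subspaceT.
have n0 : ~ (r @` B) 0.
  move=> [F BF0 /eqP]; rewrite psumr_eq0 => [/allP r0|j _]; last exact: sqr_ge0.
  apply: (Bd F) => //; split; first exact: BF.
  by move=> j; have := r0 j (mem_index_enum _); rewrite /= sqrf_eq0 subr_eq0 => /eqP.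
have : nbhs (0 : R) (~` (r @` B)) by apply: open_nbhs_nbhs; split => //; exact: closed_openC.
move=> /nbhs_ballP[e /= e0 eB]; exists e => // F FB; rewrite leNgt; apply/negP => re.
apply: (eB (r F)); last by exists F.
by rewrite /ball /= sub0r normrN ger0_norm // sumr_ge0 // => j _; exact: sqr_ge0.
Qed.

End compactness.

Theorem connected_frames (R : realType) (n k : nat) (d : 'rV[R]_n) :
  (1 <= k <= n)%N -> Delta n k d ->
  (forall S : {set 'I_n}, #|S| = (n - k)%N -> 1 <= \sum_(i in S) d 0 i) ->
  connected (frames k d).
Proof.
move=> /andP[k0 kn] [d01 sumd] dS.
(* The complement of the image of [f] has [n - k] elements and carries weight at least 1 out of the
   total [k]. *)
have dk (f : {ffun 'I_k -> 'I_n}) : injective f -> \sum_i d 0 (f i) <= k%:R - 1.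
  move=> fI; pose S := [set j | j \notin codom f]%SET.
  have cS : #|S| = (n - k)%N.
    have cC := cardC (mem (codom f)); rewrite card_ord card_codom // card_ord in cC.
    by rewrite -[in RHS]cC addKn; apply: eq_card => j; rewrite !inE.
  have := dS S cS; have := sumd; rewrite (bigID (mem S)) /=.
  have -> : \sum_(j | j \notin S) d 0 j = \sum_i d 0 (f i); last lra.
  rewrite -(sum_occ f (d 0)) big_mkcond; apply: eq_bigr => j _.
  by rewrite occ_injE // inE negbK; case: (j \in codom f); rewrite ?mul1r ?mul0r.
have ss F : frames k d F -> semistable d F by move=> [FF Fd]; exact: parseval_semistable.
apply: contrapT => /connectedPn[E [E0 FE [sep1 sep2]]].
have Eframes b : E b `<=` frames k d by rewrite FE; case: b => F; [right | left].
(* Each half of a separation of a closed set is closed. *)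
have Ec b : closed (E b).
  move=> F cF; have := closure_subset (Eframes b) cF; rewrite -(closure_id _).1;
    last exact: closed_frames.
  rewrite FE => -[] EF; case: b cF => // cF; exfalso.
    by have : (E false `&` closure (E true)) F by []; rewrite sep2.
  by have : (closure (E false) `&` E true) F by []; rewrite sep1.
have dis : E false `&` E true = set0.
  by rewrite -subset0 -sep1; apply: setSI; exact: subset_closure.
have [g [gc g0 g1 _]] := urysohn_ext_itv (@pseudometric_normal R _) (Ec false) (Ec true)
  dis (@ltr01 R).
(* The Urysohn function [g] is 0 on one half of [frames k d] and 1 on the other, so its level set at
   1/2 contains no frame with norms [d], and the norm error is bounded below on it. *)
pose B := [set F : 'M[R]_(k, n) | F *m F^T = 1%:M] `&` (g @^-1` [set 1 / 2]).
have Bd F : B F -> ~ frames k d F.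
  move=> [_ /= gF]; rewrite FE => -[] EF.
    have : g F = 0 by apply: g0; exists F.
    rewrite gF; lra.
  have : g F = 1 by apply: g1; exists F.
  rewrite gF; lra.
have Bc : closed B.
  by apply: closedI; [exact: closed_parseval | apply: closed_comp => [x _|];
    [exact: gc | exact: closed_eq]].
have [e e0 eB] := norm_error_bounded_below Bc (fun F h => h.1) Bd.
have [F0 EF0] := E0 false; have [F1 EF1] := E0 true.
have link F : frames k d F -> linked (semistable d) F (vdm R k n).
  by move=> fF; apply: linked_vdm; [exact: ss | exact: nice_semistable].
have [K [cK nK KF0 KF1 Ks]] := linked_trans (link _ (Eframes _ _ EF0)) (linked_sym (link _
  (Eframes _ _ EF1))).
have [N Ne] := residual_uniform cK Ks e0.
have fixed F : frames k d F -> balance d N F = F by move=> [FF Fd]; exact: balance_frame.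
(* Balancing fixes the two ends [F0] and [F1] of [K], so this interval contains 0 and 1, and
   therefore 1/2. *)
have /connected_intervalP itv : connected ((g \o balance d N) @` K).
  apply: connected_continuous_connected => //.
  apply: continuous_in_subspaceT => F /set_mem /Ks /semistable_sum_gt0 Fs.
  apply: continuous_comp; last exact: gc.
  by apply: (@cvg_balance _ _ _ _ _ (nbhs F)) => // i j; exact: coord_continuous.
have [F KF gF] : ((g \o balance d N) @` K) (1 / 2).
  apply: (itv 0 1); last lra.
    by exists F0 => //=; rewrite fixed; [apply: g0; exists F0 | exact: Eframes EF0].
  by exists F1 => //=; rewrite fixed; [apply: g1; exists F1 | exact: Eframes EF1].
have Fs := semistable_sum_gt0 (Ks F KF).
(* The balanced matrix lies in [B], yet its norm error is the residual, which is below [e]. *)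
have := eB (balance d N F); rewrite leNgt => /(_ _)/negP; apply.
  by split => //; exact: balance_orth.
have := Ne F KF; congr (_ < _); apply: eq_bigr => j _.
by rewrite /col_sqnorm balance_sqnorm // !mxE expr2.
Qed.

Theorem proposition6p6 (R : realType) (p k : nat) (e : 'rV[R]_p) (c : R) :
  let n := (p + p + 1)%N in
  let d : 'rV[R]_n := doubled e c in
  (1 <= k <= n)%N ->
  Delta n k d ->
  (forall S : {set 'I_n}, #|S| = (n - k)%N -> 1 <= \sum_(i in S) d 0 i) ->
  ((k - 1 <= p)%N ->
     forall d' : 'rV[R]_p,
       Delta p (k - 1) d' ->
       admissible (k - 1) d' ->
       (forall i : 'I_p, 1 / 2 * d' 0 i < e 0 i) ->
       admissible k d)
  /\
  ((p < k - 1)%N ->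
     forall d' : 'rV[R]_p,
       Delta p (n - k - 1) d' ->
       admissible (n - k - 1) d' ->
       (forall i : 'I_p, 1 / 2 * d' 0 i < 1 - e 0 i) ->
       admissible k d).
Proof.
move=> n d kn dD dS; have cd : admissible k d := connected_frames kn dD dS.
by split=> *; exact: cd.
Qed.
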